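(* Let $(\mathfrak g,J,g)$ be an almost abelian pseudo-Kähler Lie algebra of dimension six, with codimension-one abelian ideal $\mathfrak h$, such that $\mathfrak h^\perp$ is non-isotropic. Then, after possibly replacing $g$ by $-g$, there is a basis $\{e_1,\dots,e_6\}$ of $\mathfrak g$ with $\mathfrak h=\mathrm{Span}\{e_1,\dots,e_5\}$ such that $$Je_1=e_2,\ Je_3=e_4,\ Je_5=e_6,\qquad g=\gamma+\varepsilon(e^5\otimes e^5+e^6\otimes e^6),\quad\varepsilon=\pm1,$$ and the derivation $D=\mathrm{ad}(e_6)|_{\mathfrak h}$, written as a matrix in the basis $e_1,\dots,e_5$, and the metric $\gamma$ on $\mathrm{Span}\{e_1,\dots,e_4\}$ are as in one of the following, with $a,\lambda,\lambda_1,\lambda_2\in\mathbb R$ and $\rho>0$: (i) $D=\begin{pmatrix}0&\lambda_1&0&0&0\\-\lambda_1&0&0&0&0\\0&0&0&\lambda_2&0\\0&0&-\lambda_2&0&0\\0&0&0&0&a\end{pmatrix}$, $\gamma=e^1\otimes e^1+e^2\otimes e^2+e^3\otimes e^3+e^4\otimes e^4$; (ii) $D=\begin{pmatrix}0&\lambda&1&0&0\\-\lambda&0&0&1&0\\0&0&0&\lambda&0\\0&0&-\lambda&0&0\\0&0&0&0&a\end{pmatrix}$, $\gamma=e^1\odot e^4-e^2\odot e^3$; (iii) $D=\begin{pmatrix}0&\lambda_1&0&0&0\\-\lambda_1&0&0&0&0\\0&0&0&\lambda_2&0\\0&0&-\lambda_2&0&0\\0&0&0&0&a\end{pmatrix}$,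 $\gamma=e^1\otimes e^1+e^2\otimes e^2-e^3\otimes e^3-e^4\otimes e^4$; (iv) $D=\begin{pmatrix}\rho&\lambda&0&0&0\\-\lambda&\rho&0&0&0\\0&0&-\rho&\lambda&0\\0&0&-\lambda&-\rho&0\\0&0&0&0&a\end{pmatrix}$, $\gamma=e^1\odot e^4-e^2\odot e^3$.
   Context: Lie algebras are real. A Lie algebra is almost abelian if it has a codimension-one abelian ideal $\mathfrak h$. A pseudo-Kähler structure on $\mathfrak g$ is a pair $(J,g)$ with $J\in\mathrm{End}(\mathfrak g)$, $J^2=-\mathrm{Id}$, $[X,Y]+J[JX,Y]+J[X,JY]-[JX,JY]=0$; $g$ a nondegenerate symmetric bilinear form of arbitrary signature with $g(JX,JY)=g(X,Y)$; and $\omega=g(J\cdot,\cdot)$ satisfying $\omega([X,Y],Z)+\omega([Y,Z],X)+\omega([Z,X],Y)=0$. The line $\mathfrak h^\perp$ is non-isotropic if $g$ is nonzero on it. $\{e^i\}$ is the dual basis and $e^i\odot e^j=e^i\otimes e^j+e^j\otimes e^i$. *)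

(* Defs.v *)
From mathcomp Require Import all_boot all_order all_algebra.
From mathcomp Require Import sesquilinear reals.

Set Implicit Arguments.
Unset Strict Implicit.
Unset Printing Implicit Defensive.

Import GRing.Theory Num.Theory.

Local Open Scope ring_scope.

Definition lie_bracket (R : realType) (V : vectType R)
    (br : {bilinear V -> V -> V}) : Prop :=
  (forall x, br x x = 0) /\
  (forall x y z, br x (br y z) + br y (br z x) + br z (br x y) = 0).

Definition codim1_abelian_ideal (R : realType) (V : vectType R)
    (br : {bilinear V -> V -> V}) (h : {vspace V}) : Prop :=
  [/\ \dim {:V} = (\dim h).+1,
      (forall x y, y \in h -> br x y \in h) &
      (forall x y, x \in h -> y \in h -> br x y = 0)].

Definition complex_structure (R : realType) (V : vectType R)
    (br : {bilinear V -> V -> V}) (J : 'End(V)) : Prop :=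
  (forall x, J (J x) = - x) /\
  (forall x y, br x y + J (br (J x) y) + J (br x (J y)) - br (J x) (J y) = 0).

Definition fundamental_form (R : realType) (V : vectType R)
    (J : 'End(V)) (g : {symmetric V}) (x y : V) : R := g (J x) y.

Definition pseudo_kahler (R : realType) (V : vectType R)
    (br : {bilinear V -> V -> V}) (J : 'End(V)) (g : {symmetric V}) : Prop :=
  let omega := fundamental_form J g in
  [/\ complex_structure br J,
      nondegenerate g,
      (forall x y, g (J x) (J y) = g x y) &
      (forall x y z,
         omega (br x y) z + omega (br y z) x + omega (br z x) y = 0)].

(* For a hyperplane [h] and nondegenerate [g] the space [orthov g h] is a line;
   non-isotropic means that [g] does not vanish identically on it. *)
Definition non_isotropic_perp (R : realType) (V : vectType R)
    (g : {symmetric V}) (h : {vspace V}) : Prop :=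
  exists x y, [/\ x \in orthov g h, y \in orthov g h & g x y != 0].

(* Basis vectors and dual basis vectors are numbered 1, ..., 6, whereas tuples
   are indexed from 0. *)
Definition bvec (R : realType) (V : vectType R) (e : 6.-tuple V) (i : nat) : V :=
  e`_i.-1.

Definition dvec (R : realType) (V : vectType R) (e : 6.-tuple V) (i : nat)
    (x : V) : R := coord e (inord i.-1) x.

Definition tens (R : realType) (V : vectType R) (e : 6.-tuple V) (i j : nat)
    (x y : V) : R := dvec e i x * dvec e j y.

Definition odot (R : realType) (V : vectType R) (e : 6.-tuple V) (i j : nat)
    (x y : V) : R := tens e i j x y + tens e j i x y.

Definition mx5 (R : realType) (rows : seq (seq R)) : 'M[R]_5 :=
  \matrix_(i < 5, j < 5) nth 0 (nth [::] rows i) j.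

(* Column convention: column [j] of [D] lists the coordinates of [f e_j]. *)
Definition has_matrix (R : realType) (V : vectType R) (e : 6.-tuple V)
    (f : V -> V) (D : 'M[R]_5) : Prop :=
  forall j : 'I_5, f (bvec e j.+1) = \sum_(i < 5) D i j *: bvec e i.+1.

Definition D_diag (R : realType) (l1 l2 a : R) : 'M[R]_5 := mx5
  [:: [:: 0;     l1;  0;     0;   0];
      [:: - l1;  0;   0;     0;   0];
      [:: 0;     0;   0;     l2;  0];
      [:: 0;     0;   - l2;  0;   0];
      [:: 0;     0;   0;     0;   a]].

Definition D_jordan (R : realType) (l a : R) : 'M[R]_5 := mx5
  [:: [:: 0;    l;  1;    0;  0];
      [:: - l;  0;  0;    1;  0];
      [:: 0;    0;  0;    l;  0];
      [:: 0;    0;  - l;  0;  0];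
      [:: 0;    0;  0;    0;  a]].

Definition D_complex (R : realType) (rho l a : R) : 'M[R]_5 := mx5
  [:: [:: rho;  l;    0;      0;      0];
      [:: - l;  rho;  0;      0;      0];
      [:: 0;    0;    - rho;  l;      0];
      [:: 0;    0;    - l;    - rho;  0];
      [:: 0;    0;    0;      0;      a]].

Definition gamma_pos (R : realType) (V : vectType R) (e : 6.-tuple V)
    (x y : V) : R :=
  tens e 1 1 x y + tens e 2 2 x y + tens e 3 3 x y + tens e 4 4 x y.

Definition gamma_split (R : realType) (V : vectType R) (e : 6.-tuple V)
    (x y : V) : R :=
  tens e 1 1 x y + tens e 2 2 x y - tens e 3 3 x y - tens e 4 4 x y.

Definition gamma_null (R : realType) (V : vectType R) (e : 6.-tuple V)
    (x y : V) : R := odot e 1 4 x y - odot e 2 3 x y.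

(* Main.v *)
Require Import Defs.
From mathcomp Require Import all_boot all_order all_algebra.
From mathcomp Require Import sesquilinear reals ring lra.

Set Implicit Arguments.
Unset Strict Implicit.
Unset Printing Implicit Defensive.

Import Order.TTheory GRing.Theory Num.Theory.

Local Open Scope ring_scope.

(** Let [w] be a vector orthogonal to [h] with [g w w = 1] or [-1], and [W] the
    [g]-orthogonal complement of [w] and [J w].  It is a [J]-stable
    nondegenerate subspace of dimension four, contained in [h], and
    [h = W + <J w>].  Because [h] is abelian, integrability says that
    [A = ad w] commutes with [J] on [W], and closedness of the fundamental form
    then says that [A] is skew for [g] on [W] and that [J w] is an eigenvector of
    [A] ([ad_commutes], [ad_stable], [ad_skew], [ad_eigen]).  So everything
    reduces to classifying one element [A] of u(2), u(1,1) or u(0,2), up to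
    unitary change of basis and the sign of [g].

    Over the complex numbers [A] is a 2 by 2 matrix.  In a suitable unitary pair
    [u], [v] of [W], with [p = g u u] and [q = g v v], it is [m J + N] with
    [N u = d (J u) + c v] and [N v = - p q c u - d (J v)] for real [m], [d], [c]
    ([reduced_frame]): the phase of [c] is absorbed by rotating [v].  Then
    [N^2 = - K] with [K = d^2 + p q c^2], and [normal_form] splits on [K].
    - If [K = k^2 > 0], then [N x = k J x] and [N y = - k J y] have the solutions
      [x = N u + k J u] and [y = N v - k J v], which are orthogonal and not
      isotropic: forms (i) and (iii), according to whether [p q] is [1] or [-1].
      The same forms arise when [N = 0].
    - If [K = 0] and [N <> 0], then [p q = -1]; the isotropic vector
      [y = u + v] and [x = N y] give form (ii).  The sign of [g x (J y)] is an
      invariant of [N], and this is where [g] may have to be replaced by [- g].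
    - If [K = - r^2 < 0], then again [p q = -1], and eigenvectors
      for [r] and [- r] are isotropic and can be paired to give form (iv).

    The final basis is [x, J x, y, J y, - J w, w].  Its independence, and the
    formula for [g] in the dual basis, follow from exhibiting vectors [f_j] with
    [g e_i f_j] equal to [1] or [0] ([dual_family_basis]). *)

(** * Symmetric forms and unit vectors *)

Section SymmetricForm.

Variables (R : rcfType) (V : vectType R) (g : {symmetric V}).

Lemma symC x y : g x y = g y x.
Proof. by rewrite hermC expr0 mul1r. Qed.
Lemma symDl x y z : g (x + y) z = g x z + g y z.
Proof. exact: linearDl. Qed.
Lemma symDr x y z : g z (x + y) = g z x + g z y.
Proof. exact: linearDr. Qed.
Lemma symNl x z : g (- x) z = - g x z.
Proof. exact: linearNl. Qed.
Lemma symNr x z : g z (- x) = - g z x.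
Proof. exact: linearNr. Qed.
Lemma symZl a x z : g (a *: x) z = a * g x z.
Proof. exact: linearZl_LR. Qed.
Lemma symZr a x z : g z (a *: x) = a * g z x.
Proof. exact: linearZr_LR. Qed.
Lemma sym0l z : g 0 z = 0.
Proof. exact: linear0l. Qed.

Definition symE := (symDl, symDr, symNl, symNr, symZl, symZr).

(** Pairing a linear combination of the [e_i] with [f_j] extracts its
    [j]-th coefficient; this gives independence and the coordinates at once. *)
Lemma dual_family_basis n (e f : n.-tuple V) :
    \dim {:V} = n -> (forall i j : 'I_n, g e`_i f`_j = (i == j)%:R) ->
  basis_of {:V} e /\ (forall (i : 'I_n) x, coord e i x = g x f`_i).
Proof.
move=> dimV dual.
have pair_sum (k : 'I_n -> R) (j : 'I_n) : g (\sum_i k i *: e`_i) f`_j = k j.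
  rewrite linear_sumlz (bigD1 j) //= symZl dual eqxx mulr1 big1 ?addr0 // => i ij.
  by rewrite symZl dual (negPf ij) mulr0.
have free_e : free e.
  apply/freeP => k k0 i.
  by rewrite -(pair_sum k) k0 sym0l.
have basis_e : basis_of {:V} e by rewrite basisEfree free_e subvf size_tuple dimV leqnn.
split=> // i x.
by rewrite {2}(coord_basis basis_e (memvf x)) pair_sum.
Qed.

Definition nondegenerate_on (W : {vspace V}) :=
  forall x, x \in W -> (forall y, y \in W -> g x y = 0) -> x = 0.

Lemma nondegenerate_full : nondegenerate g -> nondegenerate_on {:V}.
Proof.
move=> /eqP nd x _ x0; apply/eqP; rewrite -memv0 -nd.
by apply/mem_orthovP => y /x0.
Qed.

(** By polarization, a form that does not vanish on [W] has a vector of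
    nonzero square in [W]; a square root scales that square to [1] or [-1]. *)
Lemma unit_vector_of (W : {vspace V}) a b : a \in W -> b \in W -> g a b != 0 ->
  exists2 u, u \in W & g u u ^+ 2 = 1.
Proof.
move=> aW bW gab.
have [u uW gu] : exists2 u, u \in W & g u u != 0.
  have [ga|?] := eqVneq (g a a) 0; last by exists a.
  have [gb|?] := eqVneq (g b b) 0; last by exists b.
  exists (a + b); first by rewrite rpredD.
  by rewrite !symE ga gb (symC b a) add0r addr0 -mulr2n mulrn_eq0.
have sq : Num.sqrt `|g u u| ^+ 2 = `|g u u| by rewrite sqr_sqrtr.
exists ((Num.sqrt `|g u u|)^-1 *: u); first by rewrite rpredZ.
rewrite !symE mulrA -invfM -expr2 sq exprMn exprVn real_normK ?num_real //.
by rewrite mulVf // expf_eq0.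
Qed.

Lemma unit_vector W : nondegenerate_on W -> (0 < \dim W)%N ->
  exists2 u, u \in W & g u u ^+ 2 = 1.
Proof.
move=> ndW dW.
have pW : vpick W \in W := memv_pick W.
have p0 : vpick W != 0 by rewrite vpick0 -dimv_eq0 -lt0n.
have [/mem_orthovP ort|/mem_orthovPn [b bW gb]] := boolP (vpick W \in orthov g W).
  by case/eqP: p0; apply: ndW.
exact: unit_vector_of pW bW gb.
Qed.

End SymmetricForm.

(** * Hermitian spaces and their unitary pairs *)

Section HermitianPlane.

Variables (R : rcfType) (V : vectType R) (g : {symmetric V}) (J : 'End(V)).
Hypothesis JJ : forall x, J (J x) = - x.
Hypothesis gJ : forall x y, g (J x) (J y) = g x y.

Lemma symJl x y : g (J x) y = - g x (J y).
Proof. by rewrite -(gJ x) JJ symNr opprK. Qed.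

Lemma symxJ x : g x (J x) = 0.
Proof.
have := symJl x x; rewrite symC => /eqP; rewrite -addr_eq0 -mulr2n.
by rewrite mulrn_eq0 /= => /eqP.
Qed.

Definition hermitian_space (W : {vspace V}) :=
  (forall x, x \in W -> J x \in W) /\ nondegenerate_on g W.

(** The orthogonal complement of the complex line spanned by [u] and [J u]. *)
Definition cperp (W : {vspace V}) (u : V) : {vspace V} :=
  (W :&: orthov g <[u]> :&: orthov g <[J u]>)%VS.

Lemma mem_cperp (W : {vspace V}) u x :
  reflect [/\ x \in W, g x u = 0 & g x (J u) = 0] (x \in cperp W u).
Proof.
rewrite !memv_cap !mem_orthov1 -andbA.
by apply: (iffP and3P) => -[xW /eqP xu /eqP xJu].
Qed.

(** A vector of [W] differs from a vector of [cperp W u] by a combination of [u] and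
    [J u], so a vector of [cperp W u] orthogonal to [cperp W u] is orthogonal to
    all of [W]. *)
Lemma cperp_hermitian W u : hermitian_space W -> u \in W -> g u u != 0 ->
  hermitian_space (cperp W u).
Proof.
move=> [JW ndW] uW gu; split=> [x /mem_cperp [xW xu xJu]|x].
  apply/mem_cperp; split; [exact: JW|by rewrite symJl xJu oppr0|by rewrite gJ].
move=> /mem_cperp [xW xu xJu] x0; apply: ndW => // y yW.
pose a := g y u / g u u; pose b := g y (J u) / g u u.
have -> : y = (y - a *: u - b *: J u) + (a *: u + b *: J u).
  by rewrite addrACA subrK addNr addr0.
rewrite symDr x0 ?symE ?xu ?xJu ?mulr0 ?addr0 //.
apply/mem_cperp; split.
- by rewrite !rpredB ?rpredZ ?JW.
- by rewrite !symE (symC _ (J u)) symxJ mulr0 oppr0 addr0 mulfVK // subrr.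
- by rewrite !symE symxJ mulr0 oppr0 addr0 gJ mulfVK // subrr.
Qed.

Lemma dim_cperp W u : hermitian_space W -> u \in W -> g u u != 0 ->
  \dim W = (\dim (cperp W u)).+2.
Proof.
move=> [JW ndW] uW gu.
have uV : u \notin orthov g W.
  by apply/mem_orthovPn; exists u.
have JuV : J u \notin orthov g (W :&: orthov g <[u]>).
  apply/mem_orthovPn; exists (J u); last by rewrite gJ.
  by rewrite memv_cap JW // mem_orthov1 symC symxJ eqxx.
rewrite /cperp -(eq_dim_orthov1 JuV) -(eq_dim_orthov1 uV).
have d1 : (0 < \dim (W :&: orthov g <[u]>))%N.
  rewrite lt0n dimv_eq0; apply: contra JuV => /eqP ->.
  by rewrite orthov0 memvf.
have d0 : (0 < \dim W)%N.
  rewrite lt0n dimv_eq0; apply: contra uV => /eqP ->.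
  by rewrite orthov0 memvf.
move: d1; rewrite -(eq_dim_orthov1 uV).
by case: (\dim W) d0 => [|[|?]].
Qed.

Lemma sqr1_neq0 (p : R) : p ^+ 2 = 1 -> p != 0.
Proof. by move=> pp; rewrite -sqrf_eq0 pp oner_eq0. Qed.

Definition unitary_pair (W : {vspace V}) u v :=
  [/\ u \in W /\ v \in W, g u u ^+ 2 = 1, g v v ^+ 2 = 1,
      g u v = 0 & g u (J v) = 0].

(** The difference of the two sides is orthogonal to [u], [J u], [v] and [J v],
    hence lies in a space of dimension [4 - 2 - 2 = 0]. *)
Lemma unitary_pair_expansion W u v x : hermitian_space W -> \dim W = 4 ->
  unitary_pair W u v -> x \in W ->
  x = g u u *: (g x u *: u + g x (J u) *: J u) +
      g v v *: (g x v *: v + g x (J v) *: J v).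
Proof.
move=> hW dW [[uW vW] gg gg' uv uJv] xW.
have gu0 := sqr1_neq0 gg. have gv0 := sqr1_neq0 gg'.
have vJu : g v (J u) = 0 by rewrite symC symJl uJv oppr0.
have vu : g v u = 0 by rewrite symC.
have hW' := cperp_hermitian hW uW gu0.
have dW' : \dim (cperp W u) = 2 by have := dim_cperp hW uW gu0; rewrite dW => -[].
have vW' : v \in cperp W u by apply/mem_cperp.
have /eqP : \dim (cperp (cperp W u) v) = 0.
  by have := dim_cperp hW' vW' gv0; rewrite dW' => -[].
rewrite dimv_eq0 => /eqP W''0.
have JuJv : g (J u) (J v) = 0 by rewrite gJ.
have Juv : g (J u) v = 0 by rewrite symJl uJv oppr0.
have uJu := symxJ u. have vJv := symxJ v.
have guJ := gJ u u. have gvJ := gJ v v.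
apply/eqP; rewrite -subr_eq0 -memv0 -W''0.
apply/mem_cperp; split; first apply/mem_cperp; first split.
- by rewrite rpredB // rpredD // rpredZ // rpredD // rpredZ // (hW.1 _).
- rewrite !symE (symC _ (J u)) uJu vu (symC _ (J v)) uJv; ring: gg.
- rewrite !symE uJu (symC _ v) Juv (symC _ (J v)) JuJv guJ; ring: gg.
- rewrite !symE uv Juv (symC _ (J v)) vJv; ring: gg'.
- rewrite !symE uJv JuJv vJv gvJ; ring: gg'.
Qed.

(** In complex terms, [v] may be multiplied by a phase, and a suitable phase makes
    the hermitian product of [f u] and [v] real. *)
Lemma rotated_unitary_pair W (f : V -> V) : hermitian_space W -> \dim W = 4 ->
  exists u v, unitary_pair W u v /\ g (f u) (J v) = 0.
Proof.
move=> hW dW.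
have [u uW gu] := unit_vector hW.2 (ltac:(by rewrite dW)).
have gu0 := sqr1_neq0 gu.
have hW' := cperp_hermitian hW uW gu0.
have dW' : \dim (cperp W u) = 2 by have := dim_cperp hW uW gu0; rewrite dW => -[].
have [v vW' gv] := unit_vector hW'.2 (ltac:(by rewrite dW')).
have [vW vu vJu] := mem_cperp _ _ _ vW'.
have uv : g u v = 0 by rewrite symC.
have uJv : g u (J v) = 0 by rewrite -[LHS]opprK -symJl symC vJu oppr0.
pose a := g (f u) v; pose b := g (f u) (J v).
have [b0|b0] := eqVneq b 0; first by exists u, v.
have r0 : 0 < a ^+ 2 + b ^+ 2.
  by rewrite ltr_wpDl ?sqr_ge0 // exprn_even_gt0.
have rr : Num.sqrt (a ^+ 2 + b ^+ 2) ^+ 2 = a ^+ 2 + b ^+ 2 by rewrite sqr_sqrtr // ltW.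
have rn0 : Num.sqrt (a ^+ 2 + b ^+ 2) != 0 by rewrite gt_eqF // sqrtr_gt0.
set r := Num.sqrt _ in rr rn0.
exists u, (r^-1 *: (a *: v + b *: J v)); split; last first.
  by rewrite linearZ /= linearD /= !linearZ /= JJ !symE -/a -/b; ring.
have nv : g (r^-1 *: (a *: v + b *: J v)) (r^-1 *: (a *: v + b *: J v)) = g v v.
  rewrite !symE (symC _ (J v)) symxJ gJ.
  transitivity (r ^- 2 * (a ^+ 2 + b ^+ 2) * g v v); first by field.
  by rewrite -rr mulVf ?mul1r // expf_neq0.
split; rewrite ?nv //.
- by rewrite uW rpredZ // rpredD // rpredZ // (hW.1 _).
- by rewrite !symE uv uJv; ring.
- by rewrite linearZ /= linearD /= !linearZ /= JJ !symE uv uJv; ring.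
Qed.

(** * Classification of skew-hermitian operators in complex dimension two *)

Section SkewOperator.

Variables (W : {vspace V}) (A : {linear V -> V}).
Hypotheses (hW : hermitian_space W) (dimW : \dim W = 4).
Hypothesis AW : forall x, x \in W -> A x \in W.
Hypothesis AJ : forall x, x \in W -> A (J x) = J (A x).
Hypothesis Askew : forall x y, x \in W -> y \in W -> g (A x) y + g x (A y) = 0.

(** Skewness kills the components of [A u] on [u] and of [A v] on [v], and links
    the two remaining off-diagonal entries; the rotation makes them real. *)
Lemma reduced_frame : exists u v (m d c : R),
  [/\ unitary_pair W u v, A u = (m + d) *: J u + c *: v &
      A v = - (g u u * g v v * c) *: u + (m - d) *: J v].
Proof.
have [u [v [uvP AuJv]]] := rotated_unitary_pair A hW dimW.
have [[uW vW] gu gv uv uJv] := uvP.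
have skew0 x : x \in W -> g (A x) x = 0.
  move=> xW; have := Askew xW xW; rewrite [g x _]symC => /eqP.
  by rewrite -mulr2n mulrn_eq0 => /eqP.
have Avu : g (A v) u = - g (A u) v.
  by apply/eqP; rewrite -addr_eq0 addrC (symC _ (A v)) Askew.
have AvJu : g (A v) (J u) = 0.
  have := Askew vW (hW.1 u uW); rewrite AJ // -[g v _]opprK -symJl (symC _ _ (A u)).
  by rewrite AuJv oppr0 addr0.
pose b := g u u * g (A u) (J u); pose t := g v v * g (A v) (J v).
exists u, v, ((b + t) / 2%:R), ((b - t) / 2%:R), (g v v * g (A u) v); split=> //.
  rewrite [LHS](unitary_pair_expansion hW dimW uvP (AW uW)) skew0 // AuJv !scale0r.
  rewrite add0r addr0 !scalerA; congr (_ *: _ + _).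
  by rewrite /b /t; field.
rewrite [LHS](unitary_pair_expansion hW dimW uvP (AW vW)) skew0 // AvJu Avu !scale0r.
rewrite add0r addr0 !scalerA; congr (_ *: _ + _ *: _); first by ring: gv.
by rewrite /b /t; field.
Qed.

(** Coordinates on [W] with respect to [u, J u, v, J v]: the lemmas on [comb] turn
    identities between vectors of [W] into polynomial identities in [R]. *)
Definition comb (u v : V) (a b c d : R) : V :=
  a *: u + b *: J u + (c *: v + d *: J v).

Lemma combZ u v k a b c d :
  k *: comb u v a b c d = comb u v (k * a) (k * b) (k * c) (k * d).
Proof. by rewrite /comb !scalerDr !scalerA. Qed.

Lemma combD u v a b c d a' b' c' d' :
  comb u v a b c d + comb u v a' b' c' d' =
  comb u v (a + a') (b + b') (c + c') (d + d').
Proof. by rewrite /comb !scalerDl addrACA; congr (_ + _); rewrite addrACA. Qed.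

Lemma combJ u v a b c d : J (comb u v a b c d) = comb u v (- b) a (- d) c.
Proof.
rewrite /comb !linearD /= !linearZ /= !JJ !scalerN -!scaleNr.
by rewrite (addrC (a *: _)) (addrC (c *: _)).
Qed.

Lemma comb_mem u v a b c d : u \in W -> v \in W -> comb u v a b c d \in W.
Proof. by move=> uW vW; rewrite !rpredD // rpredZ // (hW.1 _). Qed.

Lemma comb_sym u v a b c d a' b' c' d' : unitary_pair W u v ->
  g (comb u v a b c d) (comb u v a' b' c' d') =
  g u u * (a * a' + b * b') + g v v * (c * c' + d * d').
Proof.
move=> [_ _ _ uv uJv].
have Juv : g (J u) v = 0 by rewrite symJl uJv oppr0.
rewrite /comb !symE !gJ (symC _ v u) (symC _ (J v) u) (symC _ v (J u)).
rewrite (symC _ (J u) u) (symC _ (J v) v) !symxJ uv uJv Juv.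
by ring.
Qed.

(** The two summands are [m J] and the traceless part [N] of [A]. *)
Lemma combA u v (m d k e a b x y : R) : u \in W -> v \in W ->
  A u = (m + d) *: J u + k *: v -> A v = - e *: u + (m - d) *: J v ->
  A (comb u v a b x y) =
  m *: J (comb u v a b x y) +
  comb u v (- (d * b) - e * x) (d * a - e * y) (k * a + d * y) (k * b - d * x).
Proof.
move=> uW vW Au Av.
have Au' : A u = comb u v 0 (m + d) k 0.
  by rewrite Au /comb !scale0r add0r addr0.
have Av' : A v = comb u v (- e) 0 0 (m - d).
  by rewrite Av /comb !scale0r add0r addr0.
rewrite combJ combZ combD {1}/comb !linearD /= !linearZ /= !AJ // Au' Av' !combJ !combZ !combD.
by congr (comb _ _ _ _ _ _); ring.
Qed.

(** The remaining entries of the Gram matrix of [s g] on [x, J x, y, J y] follow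
    from the invariance of [g] under [J]. *)
Definition scaled_gram (s : R) (x y : V) (a b c : R) :=
  [/\ s * g x x = a, s * g y y = b, s * g x y = 0 & s * g x (J y) = c].

(** The three alternatives are: [A] is diagonalizable with imaginary eigenvalues;
    [A] is an imaginary scalar plus a nonzero nilpotent; [A] has two
    eigenvalues with opposite nonzero real parts. *)
Lemma normal_form : exists (s : R) (x y : V),
  [/\ s ^+ 2 = 1, x \in W, y \in W &
   [\/ exists l1 l2 q, [/\ q ^+ 2 = 1, scaled_gram s x y 1 q 0,
          A x = - l1 *: J x & A y = - l2 *: J y],
       exists l, [/\ scaled_gram s x y 0 0 1,
          A x = - l *: J x & A y = - l *: J y + x] |
       exists rho l, [/\ 0 < rho, scaled_gram s x y 0 0 1,
          A x = - l *: J x + rho *: x & A y = - l *: J y - rho *: y]]].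
Proof.
have [u [v [m [d [c [uvP Au Av]]]]]] := reduced_frame.
have [[uW vW] gu gv uv uJv] := uvP.
have AE := combA _ _ _ _ uW vW Au Av.
have symP := comb_sym _ _ _ _ _ _ _ _ uvP.
have inW a b x y : comb u v a b x y \in W by apply: comb_mem.
set p := g u u in gu symP Av AE; set q := g v v in gv symP Av AE.
have pq2 : (p * q) ^+ 2 = 1 by rewrite exprMn gu gv mulr1.
have [K0|K0|K0] := ltrgt0P (d ^+ 2 + p * q * c ^+ 2).
- (* [k] has the sign of [d], so that the norm [2 * k * (k + d)] of the
     eigenvectors, up to the factor [p] or [q], is positive. *)
  have [k [kk dk]] : exists k, k ^+ 2 = d ^+ 2 + p * q * c ^+ 2 /\ 0 < k * (k + d).
    have sK := sqr_sqrtr (ltW K0). have := K0; rewrite -sqrtr_gt0 => sK0.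
    have [d0|d0] := lerP 0 d.
      exists (Num.sqrt (d ^+ 2 + p * q * c ^+ 2)); split=> //.
      by rewrite mulr_gt0 // ltr_wpDr.
    exists (- Num.sqrt (d ^+ 2 + p * q * c ^+ 2)); split; first by rewrite sqrrN.
    by rewrite nmulr_rgt0 ?oppr_lt0 // ltr_wnDl // ?oppr_le0 ?ltW.
  pose t := (Num.sqrt (2 * (k * (k + d))))^-1.
  have tt : t ^+ 2 * (2 * (k * (k + d))) = 1.
    by rewrite exprVn sqr_sqrtr ?mulVf ?gt_eqF // ?ltW // mulr_gt0.
  exists p, (t *: comb u v 0 (d + k) c 0), (t *: comb u v (- (p * q * c)) 0 0 (- (d + k))).
  split; rewrite ?rpredZ //; constructor 1; exists (- (m + k)), (- (m - k)), (p * q).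
  split=> //.
  + split; rewrite ?combZ ?combJ !symP.
    * by rewrite -[RHS]tt; ring: gu kk.
    * by rewrite -[RHS]mulr1 -[X in _ = _ * X]tt; ring: gu gv kk.
    * by ring: gu gv.
    * by ring: gu gv.
  + rewrite !combZ AE !combJ !combZ !combD.
    by congr (comb _ _ _ _ _ _); ring: kk.
  + rewrite !combZ AE !combJ !combZ !combD.
    by congr (comb _ _ _ _ _ _); ring: kk.
- (* [x] is [N u + r u], and [J y] is proportional to [N v - r v]; this choice
     makes [g x y] vanish, and [g x (J y)] only needs a scaling. *)
  have {}pq2 : p * q = -1.
    move/eqP: pq2; rewrite sqrf_eq1 => /orP[/eqP pq|/eqP //].
    by move: K0; rewrite pq mul1r ltNge addr_ge0 // sqr_ge0.
  have qE : q = - p by rewrite -[q]mul1r -gu expr2 -mulrA pq2 mulrN1.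
  move: K0; rewrite pq2 mulN1r subr_lt0 -subr_gt0 => K0.
  pose r := Num.sqrt (c ^+ 2 - d ^+ 2).
  have r0 : 0 < r by rewrite sqrtr_gt0.
  have rr : r ^+ 2 = c ^+ 2 - d ^+ 2 by rewrite sqr_sqrtr // ltW.
  have c0 : c != 0.
    by rewrite -sqrf_eq0 gt_eqF // (le_lt_trans (sqr_ge0 d)) // -subr_gt0.
  have p0 := sqr1_neq0 gu. have rn0 : r != 0 by rewrite gt_eqF.
  exists 1, (comb u v r d c 0), (- (2 * p * r * c)^-1 *: comb u v 0 c d (- r)).
  split; rewrite ?expr1n ?rpredZ //; constructor 3; exists r, (- m).
  split=> //.
  + split; rewrite ?combZ ?combJ !symP qE.
    * by ring: rr.
    * by ring: rr.
    * by ring.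
    * by field; rewrite c0 p0 rn0.
  + rewrite AE opprK pq2 !combJ !combZ !combD.
    by congr (comb _ _ _ _ _ _); ring: rr.
  + rewrite -scaleNr !combZ AE !combJ opprK pq2 !combZ !combD.
    by congr (comb _ _ _ _ _ _); ring: rr.
have [c0|c0] := eqVneq c 0.
  move: K0; rewrite c0 expr0n mulr0 addr0 => /eqP; rewrite sqrf_eq0 => /eqP d0.
  exists p, u, v; split=> //; constructor 1; exists (- m), (- m), (p * q); split=> //.
  + by split; rewrite ?uv ?uJv ?mulr0 // -expr2.
  + by rewrite Au d0 c0 scale0r !addr0 opprK.
  + by rewrite Av d0 c0 mulr0 oppr0 scale0r addr0 add0r opprK.
(* The isotropic vector [u + v] is not in the kernel of [N], and
   [g (N (u + v)) (J (u + v))] is [2 * p * d]: this fixes the sign [s]. *)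
have {}pq2 : p * q = -1.
  move/eqP: pq2; rewrite sqrf_eq1 => /orP[/eqP pq|/eqP //].
  have : 0 < d ^+ 2 + p * q * c ^+ 2.
    by rewrite pq mul1r ltr_wpDl ?sqr_ge0 // exprn_even_gt0.
  by rewrite K0 ltxx.
have qE : q = - p by rewrite -[q]mul1r -gu expr2 -mulrA pq2 mulrN1.
move/eqP: K0; rewrite pq2 mulN1r subr_eq0 => /eqP dc.
have d0 : d != 0 by rewrite -sqrf_eq0 dc sqrf_eq0.
have nd : 0 < 2 * `|d| by rewrite mulr_gt0 // normr_gt0.
pose t := (Num.sqrt (2 * `|d|))^-1.
have tt : t ^+ 2 * (2 * `|d|) = 1.
  by rewrite exprVn sqr_sqrtr ?mulVf ?gt_eqF // ?ltW.
exists (p * Num.sg d), (t *: comb u v c d c (- d)), (t *: comb u v 1 0 1 0).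
split; rewrite ?rpredZ //.
  by rewrite exprMn gu sqr_sg d0 mulr1.
constructor 2; exists (- m); split.
+ split; rewrite ?combZ ?combJ !symP qE.
  * by ring.
  * by ring.
  * by ring.
  * by rewrite -[RHS]tt normrEsg; ring: gu.
+ rewrite !combZ AE !combJ opprK pq2 !combZ !combD.
  by congr (comb _ _ _ _ _ _); ring: dc.
+ rewrite !combZ AE !combJ opprK pq2 !combZ !combD.
  by congr (comb _ _ _ _ _ _); ring: dc.
Qed.

End SkewOperator.

End HermitianPlane.

(** * The derivation defined by a unit normal *)

Section AlmostAbelian.

Variables (R : realType) (V : vectType R) (br : {bilinear V -> V -> V}).
Variables (J : 'End(V)) (g : {symmetric V}) (h : {vspace V}) (w : V).
Hypotheses (hbr : lie_bracket br) (hh : codim1_abelian_ideal br h).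
Hypotheses (hJg : pseudo_kahler br J g).
Hypotheses (gw : g w w ^+ 2 = 1) (hw : h = orthov g <[w]>%VS).

Let JJ : forall x, J (J x) = - x. Proof. by case: hJg => -[]. Qed.
Let gJ : forall x y, g (J x) (J y) = g x y. Proof. by case: hJg. Qed.

Let W := cperp g J {:V} w.

Let mem_h x : (x \in h) = (g x w == 0).
Proof. by rewrite hw mem_orthov1. Qed.

Lemma transverse_sub x : x \in W -> x \in h.
Proof. by move=> /mem_cperp [_ xw _]; rewrite mem_h xw. Qed.

Lemma transverse_hermitian : hermitian_space g J W.
Proof.
apply: cperp_hermitian (memvf _) (sqr1_neq0 gw) => //.
by split=> [x _|]; [exact: memvf|apply: nondegenerate_full; case: hJg].
Qed.

Lemma dim_transverse : \dim {:V} = 6 -> \dim W = 4.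
Proof.
have := dim_cperp JJ gJ _ (memvf w) (sqr1_neq0 gw).
move=> -> => [[]//|].
by split=> [x _|]; [exact: memvf|apply: nondegenerate_full; case: hJg].
Qed.

Lemma brC x y : br x y = - br y x.
Proof.
have := hbr.1 (x + y).
rewrite linearDl !linearDr !hbr.1 add0r addr0 => /eqP.
by rewrite addr_eq0 => /eqP.
Qed.

Let Jw_h : J w \in h.
Proof. by rewrite mem_h symJl // symxJ // oppr0. Qed.

(** Integrability evaluated on [x] and [w]: two of the four brackets vanish,
    since [h] is abelian and contains [x], [J x] and [J w]. *)
Lemma ad_commutes x : x \in W -> br w (J x) = J (br w x).
Proof.
move=> xW; have JxW := transverse_hermitian.1 x xW.
have [_ _ ab] := hh.
have [[_ N] _ _ _] := hJg.
have := N x w; rewrite (ab _ _ (transverse_sub JxW) Jw_h) (ab _ _ (transverse_sub xW) Jw_h).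
rewrite linear0 subr0 addr0 brC (brC (J x)) linearN /= => /(congr1 J) /eqP.
rewrite linear0 linearB /= linearN /= JJ opprK addrC subr_eq0.
by move/eqP.
Qed.

(** Since [A] commutes with [J], the component of [A x] on [J w] is, up to sign,
    that of [A (J x)] on [w], and [A (J x)] lies in [h]. *)
Lemma ad_stable x : x \in W -> br w x \in W.
Proof.
move=> xW; have [_ id _] := hh.
have JxW := transverse_hermitian.1 x xW.
apply/mem_cperp; split; first exact: memvf.
  by apply/eqP; rewrite -mem_h id ?transverse_sub.
rewrite -[LHS]opprK -symJl // -ad_commutes //.
by apply/eqP; rewrite oppr_eq0 -mem_h id ?transverse_sub.
Qed.

(** Closedness of the fundamental form evaluated on [J x], [y] and [w]; allowing
    [y] in all of [h] covers [y = J w], which yields the eigenvector. *)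
Lemma ad_skew x y : x \in W -> y \in h -> g (br w x) y + g x (br w y) = 0.
Proof.
move=> xW yh; have [_ _ ab] := hh.
have JxW := transverse_hermitian.1 x xW.
have [_ _ _ om] := hJg.
have := om (J x) y w; rewrite /fundamental_form (ab _ _ (transverse_sub JxW) yh) linear0 sym0l add0r.
rewrite ad_commutes // JJ symNl brC linearN symNl gJ -opprD => /eqP.
by rewrite oppr_eq0 addrC (symC _ (br w y)) => /eqP.
Qed.

(** By skewness [br w (J w)] is orthogonal to [W], so its component orthogonal to
    [J w] lies in [W] and in its orthogonal. *)
Lemma ad_eigen : exists a, br w (J w) = a *: J w.
Proof.
have [_ id _] := hh.
exists (g w w * g (br w (J w)) (J w)); apply/eqP; rewrite -subr_eq0; apply/eqP.
have AJw : g (br w (J w)) w = 0 by apply/eqP; rewrite -mem_h id.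
have Jww : g (J w) w = 0 by rewrite symJl // symxJ // oppr0.
apply: transverse_hermitian.2.
  apply/mem_cperp; split; first exact: memvf.
    by rewrite !symE AJw Jww; ring.
  by rewrite !symE gJ; ring: gw.
move=> y yW; have [_ yw yJw] := mem_cperp _ _ _ _ _ (ad_stable yW).
have [_ _ yJw'] := mem_cperp _ _ _ _ _ yW.
have := ad_skew yW Jw_h; rewrite yJw add0r (symC _ y) => AJwy.
by rewrite !symE AJwy (symC _ (J w)) yJw'; ring.
Qed.

(** * The adapted basis *)

Section Basis.

Variables (x y : V) (s : R).
Hypotheses (dimV : \dim {:V} = 6) (xW : x \in W) (yW : y \in W) (ss : s ^+ 2 = 1).

(** The fifth vector is [- J w] because [J e_5] must be [e_6 = w]. *)
Definition frame : 6.-tuple V := [tuple x; J x; y; J y; - J w; w].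

Lemma frame_span : basis_of {:V} frame -> h = <<take 5 frame>>%VS.
Proof.
move=> /basis_free fr; apply/eqP; rewrite eq_sym eqEdim.
have /(@catl_free _ _ _ _) fr5 : free (take 5 frame ++ drop 5 frame) by rewrite cat_take_drop.
have -> : \dim <<take 5 frame>>%VS = 5 by move: fr5; rewrite /free => /eqP ->.
have [d _ _] := hh; move: d; rewrite dimV => -[<-]; rewrite leqnn andbT.
have [JxW JyW] := (transverse_hermitian.1 _ xW, transverse_hermitian.1 _ yW).
apply/span_subvP => z; rewrite /= !inE.
by case/or4P => [/eqP->|/eqP->|/eqP->|/orP[]/eqP->]; rewrite ?rpredN // transverse_sub.
Qed.

Lemma frame_dual (f : 6.-tuple V) :
    (forall i j : 'I_6, g frame`_i f`_j = (i == j)%:R) ->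
  basis_of {:V} frame /\
  (forall i z, (i < 6)%N -> dvec frame i.+1 z = g z f`_i).
Proof.
move=> /(dual_family_basis dimV) [bas co]; split=> // i z i6.
by rewrite /dvec co inordK.
Qed.

Lemma frame_expansion z : basis_of {:V} frame ->
  z = dvec frame 1 z *: x + dvec frame 2 z *: J x + dvec frame 3 z *: y +
      dvec frame 4 z *: J y + dvec frame 5 z *: - J w + dvec frame 6 z *: w.
Proof.
move=> bas; rewrite [LHS](coord_basis bas (memvf z)).
have coE (i : 'I_6) : coord frame i z = dvec frame i.+1 z by rewrite /dvec inord_val.
under eq_bigr => i _ do rewrite coE.
by rewrite !big_ord_recl big_ord0 /bump /= addr0 !addrA.
Qed.

(** Moving every [J] to the right-hand argument leaves only these entries; as one
    rewrite rule they compute the pairing of any two basis vectors. *)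
Lemma frame_gram a b c : scaled_gram g J s x y a b c ->
  (g x x = s * a) * (g y y = s * b) * (g x y = 0) * (g y x = 0) *
  (g x (J y) = s * c) * (g y (J x) = - (s * c)) *
  (g x w = 0) * (g w x = 0) * (g x (J w) = 0) * (g w (J x) = 0) *
  (g y w = 0) * (g w y = 0) * (g y (J w) = 0) * (g w (J y) = 0) *
  ((forall z, g z (J z) = 0) * (forall z t, g (J z) (J t) = g z t) *
   (forall z t, g (J z) t = - g z (J t))).
Proof.
move=> [gxx gyy gxy gxJy].
have s1 z a' : s * z = a' -> z = s * a' by move=> <-; ring: ss.
have [_ xw xJw] := mem_cperp _ _ _ _ _ xW.
have [_ yw yJw] := mem_cperp _ _ _ _ _ yW.
have {}gxy := s1 _ _ gxy; rewrite mulr0 in gxy.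
do !split; rewrite ?(symC _ w) ?(symC _ y x) ?(symC _ y (J x)) ?symJl //;
  rewrite ?xJw ?yJw ?oppr0 //; try exact: s1.
- by rewrite (s1 _ _ gxJy).
- by move=> z; exact: symxJ.
- by move=> z t; exact: symJl.
Qed.

Lemma diag_frame q : scaled_gram g J s x y 1 q 0 -> q ^+ 2 = 1 ->
  basis_of {:V} frame /\
  forall z t, s * g z t = tens frame 1 1 z t + tens frame 2 2 z t +
    q * tens frame 3 3 z t + q * tens frame 4 4 z t +
    s * g w w * (tens frame 5 5 z t + tens frame 6 6 z t).
Proof.
move=> gram qq; have G := frame_gram gram.
pose f : 6.-tuple V := [tuple s *: x; s *: J x; (s * q) *: y; (s * q) *: J y;
  - g w w *: J w; g w w *: w].
have [] := @frame_dual f.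
  case=> [[|[|[|[|[|[|//]]]]]] ?] [[|[|[|[|[|[|//]]]]]] ?]; rewrite /= !symE ?G /=;
  by ring: ss qq gw.
move=> bas co; split=> // z t.
rewrite {1}(frame_expansion t bas) !symE /tens !(co _ z) //= !symE.
by ring: ss qq gw.
Qed.

Lemma null_frame : scaled_gram g J s x y 0 0 1 ->
  basis_of {:V} frame /\
  forall z t, s * g z t = odot frame 1 4 z t - odot frame 2 3 z t +
    s * g w w * (tens frame 5 5 z t + tens frame 6 6 z t).
Proof.
move=> gram; have G := frame_gram gram.
pose f : 6.-tuple V := [tuple s *: J y; - s *: y; - s *: J x; s *: x;
  - g w w *: J w; g w w *: w].
have [] := @frame_dual f.
  case=> [[|[|[|[|[|[|//]]]]]] ?] [[|[|[|[|[|[|//]]]]]] ?]; rewrite /= !symE ?G /=;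
  by ring: ss gw.
move=> bas co; split=> // z t.
rewrite {1}(frame_expansion t bas) !symE /odot /tens !(co _ z) //= !symE.
by ring: ss gw.
Qed.

Lemma diag_matrix a l1 l2 : br w (J w) = a *: J w ->
  br w x = - l1 *: J x -> br w y = - l2 *: J y ->
  has_matrix frame (br (bvec frame 6)) (D_diag l1 l2 a).
Proof.
move=> Aw Ax Ay.
have AJx : br w (J x) = l1 *: x.
  by rewrite ad_commutes // Ax linearZ /= JJ scalerN scaleNr opprK.
have AJy : br w (J y) = l2 *: y.
  by rewrite ad_commutes // Ay linearZ /= JJ scalerN scaleNr opprK.
case=> [[|[|[|[|[|//]]]]] ?];
  rewrite !big_ord_recl big_ord0 !mxE /bvec /= ?linearNr ?Ax ?Ay ?AJx ?AJy ?Aw;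
  by rewrite !scale0r ?scalerN ?oppr0 ?scale1r ?add0r ?addr0.
Qed.

Lemma jordan_matrix a l : br w (J w) = a *: J w ->
  br w x = - l *: J x -> br w y = - l *: J y + x ->
  has_matrix frame (br (bvec frame 6)) (D_jordan l a).
Proof.
move=> Aw Ax Ay.
have AJx : br w (J x) = l *: x.
  by rewrite ad_commutes // Ax linearZ /= JJ scalerN scaleNr opprK.
have AJy : br w (J y) = J x + l *: y.
  by rewrite ad_commutes // Ay linearD linearZ /= JJ scalerN scaleNr opprK addrC.
rewrite addrC in Ay.
case=> [[|[|[|[|[|//]]]]] ?];
  rewrite !big_ord_recl big_ord0 !mxE /bvec /= ?linearNr ?Ax ?Ay ?AJx ?AJy ?Aw;
  by rewrite !scale0r ?scalerN ?oppr0 ?scale1r ?add0r ?addr0.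
Qed.

Lemma complex_matrix a rho l : br w (J w) = a *: J w ->
  br w x = - l *: J x + rho *: x -> br w y = - l *: J y - rho *: y ->
  has_matrix frame (br (bvec frame 6)) (D_complex rho l a).
Proof.
move=> Aw Ax; rewrite -scaleNr => Ay.
have AJx : br w (J x) = l *: x + rho *: J x.
  by rewrite ad_commutes // Ax linearD !linearZ /= JJ scalerN scaleNr opprK.
have AJy : br w (J y) = l *: y + - rho *: J y.
  by rewrite ad_commutes // Ay linearD !linearZ /= JJ scalerN -scaleNr opprK.
rewrite addrC in Ax; rewrite addrC in Ay.
case=> [[|[|[|[|[|//]]]]] ?];
  rewrite !big_ord_recl big_ord0 !mxE /bvec /= ?linearNr ?Ax ?Ay ?AJx ?AJy ?Aw;
  by rewrite !scale0r ?scalerN ?oppr0 ?scale1r ?add0r ?addr0.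
Qed.

End Basis.

End AlmostAbelian.

Lemma sqr1_sign (R : idomainType) (a : R) : a ^+ 2 = 1 -> a = 1 \/ a = -1.
Proof. by move=> /eqP; rewrite sqrf_eq1 => /orP[] /eqP; [left|right]. Qed.

(** The orthogonal of [w] contains [h] and has the same dimension. *)
Lemma unit_normal (R : realType) (V : vectType R) (g : {symmetric V}) (h : {vspace V}) :
  \dim {:V} = (\dim h).+1 -> non_isotropic_perp g h ->
  exists2 w, g w w ^+ 2 = 1 & h = orthov g <[w]>%VS.
Proof.
move=> dh [a [b [ah bh gab]]].
have [w wh gw] := unit_vector_of ah bh gab; exists w => //.
have wV : w \notin orthov g {:V}.
  by apply/mem_orthovPn; exists w; [exact: memvf|exact: sqr1_neq0].
apply/eqP; rewrite eqEdim; apply/andP; split.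
  apply/subvP => z zh; rewrite mem_orthov1 symC.
  by move/mem_orthovP: wh => ->.
by have := eq_dim_orthov1 wV; rewrite capfv dh /= => <-.
Qed.

Theorem proposition3p9 (R : realType) (V : vectType R)
    (br : {bilinear V -> V -> V}) (J : 'End(V)) (g : {symmetric V})
    (h : {vspace V})
    (hbr : lie_bracket br)
    (hdim : \dim {:V} = 6%N)
    (hh : codim1_abelian_ideal br h)
    (hJg : pseudo_kahler br J g)
    (hperp : non_isotropic_perp g h) :
  exists (s eps : R) (e : 6.-tuple V) (gamma : V -> V -> R) (D : 'M[R]_5),
    [/\ (s = 1 \/ s = -1) /\ (eps = 1 \/ eps = -1),
        basis_of {:V} e /\ h = <<take 5 e>>%VS,
        [/\ J (bvec e 1) = bvec e 2,
            J (bvec e 3) = bvec e 4 &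
            J (bvec e 5) = bvec e 6],
        (forall x y,
           s * g x y = gamma x y + eps * (tens e 5 5 x y + tens e 6 6 x y)) /\
        has_matrix e (br (bvec e 6)) D &
        [\/ (exists l1 l2 a : R, D = D_diag l1 l2 a /\ gamma = gamma_pos e),
            (exists l a : R, D = D_jordan l a /\ gamma = gamma_null e),
            (exists l1 l2 a : R, D = D_diag l1 l2 a /\ gamma = gamma_split e) |
            (exists rho l a : R,
               [/\ 0 < rho, D = D_complex rho l a & gamma = gamma_null e])]].
Proof.
have [dh _ _] := hh.
have [w gw hw] := unit_normal dh hperp.
have [[JJ _] _ gJ _] := hJg.
have hW := transverse_hermitian hJg gw.
have dW := dim_transverse hJg gw hdim.
have [a Aw] := ad_eigen hbr hh hJg gw hw.
have [s [x [y [ss xW yW cases]]]] := @normal_form _ _ g J JJ gJ _ (br w : {linear V -> V})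
  hW dW (ad_stable hbr hh hJg gw hw) (ad_commutes hbr hh hJg gw hw)
  (fun x y xW yW => ad_skew hbr hh hJg gw hw xW (transverse_sub hw yW)).
pose e := frame J w x y.
have pack gamma D : basis_of {:V} e ->
    (forall z t, s * g z t = gamma z t + s * g w w *
      (tens e 5 5 z t + tens e 6 6 z t)) ->
    has_matrix e (br (bvec e 6)) D ->
    [/\ (s = 1 \/ s = -1) /\ (s * g w w = 1 \/ s * g w w = -1),
        basis_of {:V} e /\ h = <<take 5 e>>%VS,
        [/\ J (bvec e 1) = bvec e 2,
            J (bvec e 3) = bvec e 4 &
            J (bvec e 5) = bvec e 6] &
        (forall z t, s * g z t = gamma z t + s * g w w *
          (tens e 5 5 z t + tens e 6 6 z t)) /\
        has_matrix e (br (bvec e 6)) D].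
  move=> bas met mat; split=> //.
  - by split; apply: sqr1_sign => //; rewrite exprMn ss gw mulr1.
  - by split=> //; apply: (frame_span hh hJg gw hw hdim xW yW bas).
  - by split; rewrite /bvec //= linearN /= JJ opprK.
exists s, (s * g w w), e.
case: cases => [[l1 [l2 [q [qq gram Ax Ay]]]]|[l [gram Ax Ay]]|[rho [l [rho0 gram Ax Ay]]]].
- have mat := diag_matrix hbr hh hJg gw hw xW yW Aw Ax Ay.
  have [bas met] := diag_frame hJg gw hdim xW yW ss gram qq.
  case/sqr1_sign: qq met => -> met.
    exists (gamma_pos e), (D_diag l1 l2 a).
    have [|? ? ? ?] := pack (gamma_pos e) _ bas _ mat; last first.
      by split=> //; constructor 1; exists l1, l2, a.
    by move=> z t; rewrite met /gamma_pos !mul1r.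
  exists (gamma_split e), (D_diag l1 l2 a).
  have [|? ? ? ?] := pack (gamma_split e) _ bas _ mat; last first.
    by split=> //; constructor 3; exists l1, l2, a.
  by move=> z t; rewrite met /gamma_split !mulN1r.
- have mat := jordan_matrix hbr hh hJg gw hw xW yW Aw Ax Ay.
  have [bas met] := null_frame hJg gw hdim xW yW ss gram.
  exists (gamma_null e), (D_jordan l a).
  have [? ? ? ?] := pack (gamma_null e) _ bas met mat.
  by split=> //; constructor 2; exists l, a.
have mat := complex_matrix hbr hh hJg gw hw xW yW Aw Ax Ay.
have [bas met] := null_frame hJg gw hdim xW yW ss gram.
exists (gamma_null e), (D_complex rho l a).
have [? ? ? ?] := pack (gamma_null e) _ bas met mat.
by split=> //; constructor 4; exists rho, l, a.
Qed.
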